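(* Let $(\mathcal{A},\Theta)$ be an extriangulated length category. Let $X,Y_1,\dots,Y_n\in\mathrm{ind}(\mathcal{A})$ and let $k$ be such that $\Theta^{\ast}(Y_k)=\max\{\Theta^{\ast}(Y_i)\mid 1\le i\le n\}$. Suppose that $f=(f_1,\dots,f_n)^{T}:X\to Y=\bigoplus_{i=1}^{n}Y_i$ is a $\Theta$-inflation. Then $\Theta^{\ast}(X)\le\Theta^{\ast}(Y_k)$. Moreover, if $\Theta^{\ast}(X)=\Theta^{\ast}(Y_k)$, then there exists $s\in\{1,\dots,n\}$ such that the component $f_s:X\to Y_s$ is an isomorphism and $\Theta^{\ast}(Y_s)=\Theta^{\ast}(Y_k)$.
   Context: All categories are skeletally small and Krull-Schmidt; $\mathbb{N}$ contains $0$. Extriangulated categories (Nakaoka-Palu). Let $\mathcal{A}$ be an additive category and $\mathbb{E}:\mathcal{A}^{\mathrm{op}}\times\mathcal{A}\to \mathrm{Ab}$ a biadditive functor. For $\delta\in\mathbb{E}(C,A)$, $a:A\to A'$, $c:C'\to C$ write $a_\ast\delta=\mathbb{E}(C,a)(\delta)$, $c^\ast\delta=\mathbb{E}(c,A)(\delta)$. For $\delta\in\mathbb{E}(C,A)$, $\delta'\in\mathbb{E}(C',A')$, a morphism $(a,c):\delta\to\delta'$ is a pair $a:A\to A'$, $c:C\to C'$ with $a_\ast\delta=c^\ast\delta'$. Sequences $A\to B\to C$ and $A\to B'\to C$ are equivalent if there is an isomorphism $B\to B'$ commuting with the given maps and the identities of $A$, $C$. A realization $\mathfrak{s}$ assigns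 to each $\delta\in\mathbb{E}(C,A)$ an equivalence class $\mathfrak{s}(\delta)=[A\xrightarrow{x}B\xrightarrow{y}C]$ such that for every morphism $(a,c):\delta\to\delta'$ with $\mathfrak{s}(\delta')=[A'\xrightarrow{x'}B'\xrightarrow{y'}C']$ there is $b:B\to B'$ with $bx=x'a$, $y'b=cy$ (then $(a,b,c)$ realizes $(a,c)$). It is additive if $\mathfrak{s}(0)=[A\to A\oplus C\to C]$ (canonical maps) and $\mathfrak{s}(\delta\oplus\delta')=\mathfrak{s}(\delta)\oplus\mathfrak{s}(\delta')$. $(\mathcal{A},\mathbb{E},\mathfrak{s})$ is extriangulated if $\mathfrak{s}$ is an additive realization of $\mathbb{E}$ and: (ET3) for $\mathfrak{s}(\delta)=[A\xrightarrow{x}B\xrightarrow{y}C]$, $\mathfrak{s}(\delta')=[A'\xrightarrow{x'}B'\xrightarrow{y'}C']$ and $a,b$ with $bx=x'a$ there is $c$ such that $(a,c):\delta\to\delta'$ is a morphism realized by $(a,b,c)$; (ET4) for $\delta\in\mathbb{E}(D,A)$, $\delta'\in\mathbb{E}(F,B)$ realized by $A\xrightarrow{f}B\xrightarrow{f'}D$ and $B\xrightarrow{g}C\xrightarrow{g'}F$ there are an object $E$, morphisms $h=gf:A\to C$, $h':C\to E$, $d:D\to E$, $e:E\to F$ with $h'g=df'$, $eh'=g'$, and $\delta''\in\mathbb{E}(E,A)$ realized by $A\xrightarrow{h}C\xrightarrow{h'}E$, such that $D\xrightarrow{d}E\xrightarrow{e}F$ realizes $f'_\ast\delta'$, $d^\ast\delta''=\delta$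 and $f_\ast\delta''=e^\ast\delta'$; and the duals of (ET3), (ET4) hold. If $\mathfrak{s}(\delta)=[A\xrightarrow{x}B\xrightarrow{y}C]$, then $A\xrightarrow{x}B\xrightarrow{y}C\overset{\delta}{\dashrightarrow}$ is called an $\mathbb{E}$-triangle. Length categories. $\mathrm{Iso}(\mathcal{A})$ is the set of isomorphism classes of objects. A length function is a map $\Theta:\mathrm{Iso}(\mathcal{A})\to\mathbb{N}$ with $\Theta(X)=0$ iff $X\cong 0$, and $\Theta(L)\le\Theta(X)+\Theta(M)$ for every $\mathbb{E}$-triangle $X\to L\to M\overset{\delta}{\dashrightarrow}$, with equality if $\delta=0$. An $\mathbb{E}$-triangle $X\xrightarrow{x}L\xrightarrow{y}M\dashrightarrow$ is stable if $\Theta(L)=\Theta(X)+\Theta(M)$; then $x$ is a $\Theta$-inflation and $y$ a $\Theta$-deflation. A morphism is $\Theta$-admissible if it factors as a $\Theta$-deflation followed by a $\Theta$-inflation. $((\mathcal{A},\mathbb{E},\mathfrak{s}),\Theta)$, written $(\mathcal{A},\Theta)$, is an (extriangulated) length category if every morphism of $\mathcal{A}$ is $\Theta$-admissible. Gabriel-Roiter measure. $\mathrm{ind}(\mathcal{A})$ is the set of isomorphism classes of indecomposable objects, partially ordered by $X\le Y$ iff there is a $\Theta$-inflation $X\to Y$. For a poset $P$, $\mathrm{Ch}(P)$ is the set of finite totally ordered subsets of $P$, and $\mathrm{Ch}(P,x)$ the set of those with maximal element $x$. $\mathrm{Ch}(\mathbb{N})$ carries the (total) lexicographical order: $\mathbf{X}\le\mathbf{Y}$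 iff $\min(\mathbf{Y}\setminus\mathbf{X})\le\min(\mathbf{X}\setminus\mathbf{Y})$, where $\min\emptyset$ is larger than every element of $\mathbb{N}$. The Gabriel-Roiter measure is $\Theta^{\ast}:\mathrm{ind}(\mathcal{A})\to\mathrm{Ch}(\mathbb{N})$, $\Theta^{\ast}(X)=\max\{\Theta(\mathbf{X})\mid\mathbf{X}\in\mathrm{Ch}(\mathrm{ind}(\mathcal{A}),X)\}$, where $\Theta(\mathbf{X})=\{\Theta(X')\mid X'\in\mathbf{X}\}$. *)

(* Defs.v *)
From mathcomp Require Import all_boot all_order all_algebra finmap.
From mathcomp Require Import boolp classical_sets functions cardinality.

Set Implicit Arguments.
Unset Strict Implicit.
Unset Printing Implicit Defensive.

Import GRing.Theory.

Local Open Scope classical_set_scope.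
Local Open Scope ring_scope.

Definition quot (T : Type) (R : T -> T -> Prop) : Type :=
  {P : set T | exists x, P = R x}.

Definition cls (T : Type) (R : T -> T -> Prop) (x : T) : quot R :=
  exist _ (R x) (ex_intro _ x erefl).

(** The zero object and the binary biproducts are chosen. [comp g f] is "g
    after f". Like any [Type], the type of objects is small in its universe, so
    skeletal smallness is automatic. *)
Record addCat := AddCat {
  Obj :> Type;
  Hom : Obj -> Obj -> zmodType;
  idm : forall X, Hom X X;
  comp : forall X Y Z, Hom Y Z -> Hom X Y -> Hom X Z;
  compA : forall W X Y Z (h : Hom Y Z) (g : Hom X Y) (f : Hom W X),
    comp h (comp g f) = comp (comp h g) f;
  comp_idl : forall X Y (f : Hom X Y), comp (idm Y) f = f;
  comp_idr : forall X Y (f : Hom X Y), comp f (idm X) = f;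
  compDl : forall X Y Z (g g' : Hom Y Z) (f : Hom X Y),
    comp (g + g') f = comp g f + comp g' f;
  compDr : forall X Y Z (g : Hom Y Z) (f f' : Hom X Y),
    comp g (f + f') = comp g f + comp g f';
  zobj : Obj;
  zobj_initial : forall X (f : Hom zobj X), f = 0;
  zobj_terminal : forall X (f : Hom X zobj), f = 0;
  oplus : Obj -> Obj -> Obj;
  in1 : forall X Y, Hom X (oplus X Y);
  in2 : forall X Y, Hom Y (oplus X Y);
  pr1 : forall X Y, Hom (oplus X Y) X;
  pr2 : forall X Y, Hom (oplus X Y) Y;
  pr1_in1 : forall X Y, comp (pr1 X Y) (in1 X Y) = idm X;
  pr2_in2 : forall X Y, comp (pr2 X Y) (in2 X Y) = idm Y;
  pr1_in2 : forall X Y, comp (pr1 X Y) (in2 X Y) = 0;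
  pr2_in1 : forall X Y, comp (pr2 X Y) (in1 X Y) = 0;
  oplus_id : forall X Y,
    comp (in1 X Y) (pr1 X Y) + comp (in2 X Y) (pr2 X Y) = idm (oplus X Y)
}.

Arguments idm {a} X.
Arguments zobj {a}.
Arguments in1 {a X Y}.
Arguments in2 {a X Y}.
Arguments pr1 {a X Y}.
Arguments pr2 {a X Y}.

Declare Scope cat_scope.
Delimit Scope cat_scope with cat.
Notation "X ~> Y" := (Hom X Y) (at level 90, right associativity) : cat_scope.
Notation "g <o> f" := (comp g f) (at level 40, left associativity) : cat_scope.
Notation "X (+o) Y" := (oplus X Y) (at level 50, left associativity) : cat_scope.
Local Open Scope cat_scope.

Section AdditiveCategory.
Variable A : addCat.

Definition is_iso (X Y : A) (f : X ~> Y) : Prop :=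
  exists g : Y ~> X, g <o> f = idm X /\ f <o> g = idm Y.

Definition isomorphic (X Y : A) : Prop := exists f : X ~> Y, is_iso f.

Definition hom_oplus (X Y X' Y' : A) (f : X ~> Y) (g : X' ~> Y') :
    X (+o) X' ~> Y (+o) Y' :=
  in1 <o> f <o> pr1 + in2 <o> g <o> pr2.

Definition is_direct_sum (n : nat) (Y : 'I_n -> A) (S : A)
    (iota : forall i, Y i ~> S) (pi : forall i, S ~> Y i) : Prop :=
  [/\ forall i, pi i <o> iota i = idm (Y i),
      forall i j, i != j -> pi j <o> iota i = 0
    & \sum_(i < n) iota i <o> pi i = idm S].

Definition indecomposable (X : A) : Prop :=
  ~ isomorphic X zobj /\
  forall Y Z : A, isomorphic X (Y (+o) Z) ->
    isomorphic Y zobj \/ isomorphic Z zobj.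

(** The ring End(X) is local: it is nonzero and its nonunits are closed under
    addition. *)
Definition local_End (X : A) : Prop :=
  idm X <> 0 /\
  forall f g : X ~> X, ~ is_iso f -> ~ is_iso g -> ~ is_iso (f + g).

Definition krull_schmidt : Prop :=
  forall X : A, exists (n : nat) (Y : 'I_n -> A)
    (iota : forall i, Y i ~> X) (pi : forall i, X ~> Y i),
    is_direct_sum iota pi /\ forall i, local_End (Y i).

Definition Iso : Type := quot isomorphic.

Definition iso_cls (X : A) : Iso := cls isomorphic X.

Definition ind : set Iso := [set iso_cls X | X in indecomposable].

End AdditiveCategory.

(** [Ext C X] is E(C, X), contravariant in [C] and covariant in [X]; [push a d]
    is a_* d and [pull c d] is c^* d. *)
Record biaddFunctor (A : addCat) := BiaddFunctor {
  Ext :> A -> A -> zmodType;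
  push : forall (C X X' : A), (X ~> X') -> Ext C X -> Ext C X';
  pull : forall (C C' X : A), (C' ~> C) -> Ext C X -> Ext C' X;
  pushD : forall C X X' (a : X ~> X') (d d' : Ext C X),
    push a (d + d') = push a d + push a d';
  pullD : forall C C' X (c : C' ~> C) (d d' : Ext C X),
    pull c (d + d') = pull c d + pull c d';
  push_id : forall C X (d : Ext C X), push (idm X) d = d;
  pull_id : forall C X (d : Ext C X), pull (idm C) d = d;
  push_comp : forall C X X' X'' (a' : X' ~> X'') (a : X ~> X') (d : Ext C X),
    push (a' <o> a) d = push a' (push a d);
  pull_comp : forall C C' C'' X (c : C' ~> C) (c' : C'' ~> C') (d : Ext C X),
    pull (c <o> c') d = pull c' (pull c d);
  push_pull : forall C C' X X' (a : X ~> X') (c : C' ~> C) (d : Ext C X),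
    push a (pull c d) = pull c (push a d);
  push_add : forall C X X' (a a' : X ~> X') (d : Ext C X),
    push (a + a') d = push a d + push a' d;
  pull_add : forall C C' X (c c' : C' ~> C) (d : Ext C X),
    pull (c + c') d = pull c d + pull c' d
}.

Section Extriangulated.
Variables (A : addCat) (E : biaddFunctor A).

Definition is_ext_morphism (C X C' X' : A) (d : E C X) (d' : E C' X')
    (a : X ~> X') (c : C ~> C') : Prop :=
  push a d = pull c d'.

(** The element of E(C (+) C', X (+) X') with components (d, 0, 0, d'). *)
Definition ext_oplus (C X C' X' : A) (d : E C X) (d' : E C' X') :
    E (C (+o) C') (X (+o) X') :=
  push in1 (pull pr1 d) + push in2 (pull pr2 d').

Record seq3 (X Z : A) := Seq3 {
  mid : A;
  fst3 : X ~> mid;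
  snd3 : mid ~> Z
}.

Definition seq3_equiv (X Z : A) (p q : seq3 X Z) : Prop :=
  exists b : mid p ~> mid q,
    [/\ is_iso b, b <o> fst3 p = fst3 q & snd3 q <o> b = snd3 p].

Definition assignment : Type :=
  forall (C X : A), E C X -> quot (@seq3_equiv X C).

Variable s : assignment.

Definition etriangle (X B C : A) (x : X ~> B) (y : B ~> C) (d : E C X) : Prop :=
  s d = cls (@seq3_equiv X C) (Seq3 x y).

Definition is_realization : Prop :=
  forall (X B C X' B' C' : A) (x : X ~> B) (y : B ~> C) (d : E C X)
    (x' : X' ~> B') (y' : B' ~> C') (d' : E C' X') (a : X ~> X') (c : C ~> C'),
    etriangle x y d -> etriangle x' y' d' -> is_ext_morphism d d' a c ->
    exists b : B ~> B', b <o> x = x' <o> a /\ y' <o> b = c <o> y.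

Definition is_additive_realization : Prop :=
  [/\ is_realization,
      forall X C : A, etriangle (@in1 A X C) (@pr2 A X C) (0 : E C X)
    & forall (X B C X' B' C' : A) (x : X ~> B) (y : B ~> C) (d : E C X)
        (x' : X' ~> B') (y' : B' ~> C') (d' : E C' X'),
        etriangle x y d -> etriangle x' y' d' ->
        etriangle (hom_oplus x x') (hom_oplus y y') (ext_oplus d d')].

Definition ET3 : Prop :=
  forall (X B C X' B' C' : A) (x : X ~> B) (y : B ~> C) (d : E C X)
    (x' : X' ~> B') (y' : B' ~> C') (d' : E C' X') (a : X ~> X') (b : B ~> B'),
    etriangle x y d -> etriangle x' y' d' -> b <o> x = x' <o> a ->
    exists c : C ~> C', is_ext_morphism d d' a c /\ y' <o> b = c <o> y.

Definition ET3op : Prop :=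
  forall (X B C X' B' C' : A) (x : X ~> B) (y : B ~> C) (d : E C X)
    (x' : X' ~> B') (y' : B' ~> C') (d' : E C' X') (b : B ~> B') (c : C ~> C'),
    etriangle x y d -> etriangle x' y' d' -> y' <o> b = c <o> y ->
    exists a : X ~> X', is_ext_morphism d d' a c /\ b <o> x = x' <o> a.

Definition ET4 : Prop :=
  forall (X B C D F : A) (f : X ~> B) (f' : B ~> D) (delta : E D X)
    (g : B ~> C) (g' : C ~> F) (delta' : E F B),
    etriangle f f' delta -> etriangle g g' delta' ->
    exists (G : A) (h' : C ~> G) (d : D ~> G) (e : G ~> F) (delta'' : E G X),
      [/\ h' <o> g = d <o> f', e <o> h' = g' & etriangle (g <o> f) h' delta''] /\
      [/\ etriangle d e (push f' delta'),
          pull d delta'' = delta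
        & push f delta'' = pull e delta'].

(** [ET4] for the opposite category, whose bifunctor is (C, X) |-> E(X, C). *)
Definition ET4op : Prop :=
  forall (X B C D F : A) (f' : D ~> B) (f : B ~> X) (delta : E X D)
    (g' : F ~> C) (g : C ~> B) (delta' : E B F),
    etriangle f' f delta -> etriangle g' g delta' ->
    exists (G : A) (h' : G ~> C) (d : G ~> D) (e : F ~> G) (delta'' : E X G),
      [/\ g <o> h' = f' <o> d, h' <o> e = g' & etriangle h' (f <o> g) delta''] /\
      [/\ etriangle e d (pull f' delta'),
          push d delta'' = delta
        & pull f delta'' = push e delta'].

Definition extriangulated : Prop :=
  is_additive_realization /\ [/\ ET3, ET3op, ET4 & ET4op].

Variable Theta : Iso A -> nat.

Definition length_function : Prop :=
  [/\ forall X : A, Theta (iso_cls X) = 0%N <-> isomorphic X zobj,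
      forall (X L M : A) (x : X ~> L) (y : L ~> M) (d : E M X),
        etriangle x y d ->
        (Theta (iso_cls L) <= Theta (iso_cls X) + Theta (iso_cls M))%N
    & forall (X L M : A) (x : X ~> L) (y : L ~> M),
        etriangle x y (0 : E M X) ->
        Theta (iso_cls L) = (Theta (iso_cls X) + Theta (iso_cls M))%N].

Definition stable (X L M : A) (x : X ~> L) (y : L ~> M) (d : E M X) : Prop :=
  etriangle x y d /\
  Theta (iso_cls L) = (Theta (iso_cls X) + Theta (iso_cls M))%N.

Definition inflation (X L : A) (x : X ~> L) : Prop :=
  exists (M : A) (y : L ~> M) (d : E M X), stable x y d.

Definition deflation (L M : A) (y : L ~> M) : Prop :=
  exists (X : A) (x : X ~> L) (d : E M X), stable x y d.

Definition admissible (X Y : A) (f : X ~> Y) : Prop :=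
  exists (Z : A) (p : X ~> Z) (i : Z ~> Y),
    [/\ deflation p, inflation i & f = i <o> p].

Definition length_category : Prop :=
  [/\ extriangulated, length_function
    & forall (X Y : A) (f : X ~> Y), admissible f].

Definition ind_le (c c' : Iso A) : Prop :=
  exists (X Y : A) (f : X ~> Y), [/\ c = iso_cls X, c' = iso_cls Y & inflation f].

End Extriangulated.

(** Finite chains of a poset with carrier [P] and order [le]; [Ch_at] is
    Ch(P, x). *)
Definition Ch (T : Type) (P : set T) (le : T -> T -> Prop) : set (set T) :=
  [set C | [/\ finite_set C, C `<=` P
             & forall a b, C a -> C b -> le a b \/ le b a]].

Definition Ch_at (T : Type) (P : set T) (le : T -> T -> Prop) (x : T) :
    set (set T) :=
  [set C | Ch P le C /\ (C x /\ forall a, C a -> le a x)].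

(** N with a largest element [None] added, where min(emptyset) lies. *)
Definition min_inf (S : {fset nat}) : option nat := ohead (sort leq S).

Definition le_inf (u v : option nat) : bool :=
  match u, v with
  | _, None => true
  | None, Some _ => false
  | Some m, Some n => (m <= n)%N
  end.

(** Every finite subset of N is a chain, so Ch(N) is [{fset nat}]. *)
Definition lex_le (U V : {fset nat}) : bool :=
  le_inf (min_inf (V `\` U)%fset) (min_inf (U `\` V)%fset).

Definition is_max (S : set {fset nat}) (m : {fset nat}) : Prop :=
  S m /\ forall u, S u -> lex_le u m.

(** The value [fset0] is irrelevant: it is taken only if [S] has no maximum. *)
Definition max_Ch (S : set {fset nat}) : {fset nat} := xget fset0 (is_max S).

(** Meaningful only for [c] in [ind A]. *)
Definition GR_measure (A : addCat) (E : biaddFunctor A) (s : assignment E)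
    (Theta : Iso A -> nat) (c : Iso A) : {fset nat} :=
  max_Ch [set fset_set (Theta @` C) | C in Ch_at (@ind A) (ind_le s Theta) c].

(* Main.v *)
Require Import Defs.
From mathcomp Require Import all_boot all_order all_algebra finmap.
From mathcomp Require Import boolp classical_sets functions cardinality.
From mathcomp Require Import zify.

(** Induction on the length of X, for a family of maps f_i : X -> Y_i such that
    some sum of g_i f_i is an inflation. Factor f_i as a deflation X -> Z_i
    followed by an inflation Z_i -> Y_i. If some Z_i is as long as X, then f_i
    is itself an inflation and the measures of X and Y_i compare at once.
    Otherwise decompose each Z_i into indecomposables Z_ij, all shorter than X.
    Let X' be the top of a chain computing the measure of X, with X removed. By
    induction either some X' -> X -> Z_ij is an isomorphism, so that X' splits
    off X, which is absurd, or the measure of X' is smaller than that of some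
    Z_ij; since Z_ij is shorter than X, the entry added by X comes too late in
    the lexicographical order to change this.

    Inflations need not be monomorphisms here. The splitting arguments rest on
    the fact that idempotents split, which admissibility yields by induction on
    the length. *)

Set Implicit Arguments.
Unset Strict Implicit.
Unset Printing Implicit Defensive.

(* [Defs] last: its [comp] and [compA] must shadow those of ssrfun. *)
Import GRing.Theory Defs.

Local Open Scope classical_set_scope.
Local Open Scope cat_scope.

(** * The lexicographical order on finite sets of naturals *)

Section LexicographicOrder.
Implicit Types U V W : {fset nat}.

(** [m] is the least element of the symmetric difference, and it lies in the larger set. *)
Definition lex_lt U V : Prop :=
  exists m, [/\ m \in V, m \notin U & forall i, (i < m)%N -> (i \in U) = (i \in V)].

Lemma min_infP U :
  match min_inf U with
  | None => U = fset0
  | Some m => m \in U /\ forall i, i \in U -> (m <= i)%N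
  end.
Proof.
rewrite /min_inf; have srt := sort_sorted leq_total U.
case def: (sort leq U) srt => [|m r] /= srt.
  by apply/fsetP => i; rewrite -(mem_sort leq) def in_fset0.
split=> [|i]; first by rewrite -(mem_sort leq) def mem_head.
rewrite -(mem_sort leq) def inE => /predU1P[->//|ir].
by have /allP/(_ i ir) := order_path_min leq_trans srt.
Qed.

(** The two differences are disjoint, so their minima agree only when both are empty; otherwise the
    smaller minimum is the first place where the sets differ. *)
Lemma lex_leP U V : lex_le U V <-> U = V \/ lex_lt U V.
Proof.
rewrite /lex_le; have := min_infP (V `\` U)%fset; have := min_infP (U `\` V)%fset.
have eqD i : i \notin (U `\` V)%fset -> i \notin (V `\` U)%fset -> (i \in U) = (i \in V).
  by rewrite !inE; case: (i \in U); case: (i \in V).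
case: (min_inf (U `\` V)%fset) => [a|]; case: (min_inf (V `\` U)%fset) => [b|] /=.
- move=> [aU amin] [bV bmin]; split=> [leba|].
    right; exists b; move: (bV); rewrite !inE => /andP[-> ->]; split=> // i ib.
    apply: eqD; apply/negP=> h.
      by have := leq_ltn_trans (amin _ h) ib; rewrite ltnNge leba.
    by have := leq_ltn_trans (bmin _ h) ib; rewrite ltnn.
  move=> [eqUV|[m [mV mU mE]]]; first by move: aU; rewrite eqUV !inE andNb.
  have bm : (b <= m)%N by apply: bmin; rewrite !inE mU.
  apply: leq_trans bm _; rewrite leqNgt; apply/negP=> /mE.
  by move: aU; rewrite !inE => /andP[/negPf-> ->].
- move=> [aU amin] V0; split=> // -[eqUV|[m [mV mU _]]].
    by move: aU; rewrite eqUV !inE andNb.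
  by have : m \in (V `\` U)%fset; [rewrite !inE mU | rewrite V0 inE].
- move=> U0 [bV bmin]; split=> // _.
  right; exists b; move: (bV); rewrite !inE => /andP[-> ->]; split=> // i ib.
  apply: eqD; first by rewrite U0.
  by apply/negP=> h; have := leq_ltn_trans (bmin _ h) ib; rewrite ltnn.
- move=> U0 V0; split=> // _; left; apply/fsetP => i.
  by apply: eqD; rewrite ?U0 ?V0.
Qed.

Lemma lex_le_total U V : lex_le U V || lex_le V U.
Proof.
rewrite /lex_le; case: (min_inf (V `\` U)%fset) => [a|];
  case: (min_inf (U `\` V)%fset) => [b|] //=.
exact: leq_total.
Qed.

Lemma lex_lexx U : lex_le U U.
Proof. by apply/lex_leP; left. Qed.

Lemma lex_ltxx U : ~ lex_lt U U.
Proof. by case=> m [mU /negP]. Qed.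

Lemma lex_lt_trans V U W : lex_lt U V -> lex_lt V W -> lex_lt U W.
Proof.
(* The earlier of the two first differences decides; they cannot coincide, since [m] is in [V] and
   [n] is not. *)
move=> [m [mV mU mE]] [n [nW nV nE]]; exists (minn m n).
case: (ltngtP m n) => [mn|nm|eqmn].
- rewrite -(nE _ mn); split=> // i im; rewrite mE // nE //.
  exact: ltn_trans im mn.
- rewrite (mE _ nm); split=> // i im; rewrite mE ?nE //.
  exact: ltn_trans im nm.
- by rewrite -eqmn mV in nV.
Qed.

Lemma lex_le_lt_trans V U W : lex_le U V -> lex_lt V W -> lex_lt U W.
Proof. by move=> /lex_leP[->//|]; apply: lex_lt_trans. Qed.

Lemma lex_lt_le_trans V U W : lex_lt U V -> lex_le V W -> lex_lt U W.
Proof. by move=> UV /lex_leP[<-//|]; apply: lex_lt_trans. Qed.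

Lemma lex_le_trans V U W : lex_le U V -> lex_le V W -> lex_le U W.
Proof.
move=> /lex_leP[->//|UV] VW; apply/lex_leP; right.
exact: lex_lt_le_trans UV VW.
Qed.

Lemma lex_lt0 V b : b \in V -> lex_lt fset0 V.
Proof.
move=> bV; have := min_infP V.
case: (min_inf V) => [m [mV mmin]|V0]; last by rewrite V0 inE in bV.
exists m; split; rewrite ?inE // => i im.
by rewrite inE; apply/esym/negP => /mmin; rewrite leqNgt im.
Qed.

Lemma lex_lt_fsetU1 U b : b \notin U -> lex_lt U (b |` U)%fset.
Proof.
move=> bU; exists b; split; rewrite ?fset1U1 // => i ib.
by rewrite !inE ltn_eqF.
Qed.

(** The first difference lies in [V], hence below [b], so inserting [b] comes too late to affect it.
    This absorbs the entry that an object adds to its own measure. *)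
Lemma fsetU1_lex_lt U V b : (forall i, i \in V -> (i < b)%N) ->
  lex_lt U V -> lex_lt (b |` U)%fset V.
Proof.
move=> ltVb [m [mV mU mE]]; have mb := ltVb _ mV.
exists m; split=> // [|i im]; first by rewrite !inE ltn_eqF.
by rewrite !inE ltn_eqF ?mE // (ltn_trans im).
Qed.

Lemma is_max_exists (S : set {fset nat}) (N : nat) :
  S !=set0 -> (forall U i, S U -> i \in U -> (i <= N)%N) -> exists m, is_max S m.
Proof.
move=> [U0 SU0] bnd.
have max_in (r : seq {fset nat}) : exists m, S m /\ forall u, u \in r -> S u -> lex_le u m.
  elim: r => [|u r [m [Sm mmax]]]; first by exists U0.
  have [Su|nSu] := pselect (S u); last first.
    exists m; split=> // v; rewrite inE => /predU1P[->//|]; exact: mmax.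
  have /orP[um|mu] := lex_le_total u m.
    exists m; split=> // v; rewrite inE => /predU1P[->//|]; exact: mmax.
  exists u; split=> // v; rewrite inE => /predU1P[->|vr Sv]; first by rewrite lex_lexx.
  exact: lex_le_trans (mmax _ vr Sv) mu.
(* Every member of [S] lies in the finite power set of the numbers up to [N]. *)
have [m [Sm mmax]] := max_in (fpowerset [fset i in iota 0 N.+1]%fset).
exists m; split=> // u Su; apply: mmax => //.
rewrite fpowersetE; apply/fsubsetP => i iu.
have iN : i \in iota 0 N.+1 by rewrite mem_iota ltnS (bnd u).
by apply/imfsetP; exists i.
Qed.

End LexicographicOrder.

Local Open Scope ring_scope.

(** * Additive categories *)

Lemma cls_inj (T : Type) (R : T -> T -> Prop) (x y : T) :
  R y y -> cls R x = cls R y -> R x y.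
Proof. by move=> Ryy [->]. Qed.

Lemma cls_eq (T : Type) (R : T -> T -> Prop) (x y : T) :
  (forall x y, R x y -> R y x) -> (forall x y z, R x y -> R y z -> R x z) ->
  R x y -> cls R x = cls R y.
Proof.
move=> Rsym Rtrans Rxy; apply: eq_exist; apply/funext => z; apply/propext.
by split=> [/(Rtrans _ _ _ (Rsym _ _ Rxy))|/(Rtrans _ _ _ Rxy)].
Qed.

Section AdditiveCategory.
Variable A : addCat.
Implicit Types X Y Z : A.

Lemma comp0l X Y Z (f : X ~> Y) : (0 : Y ~> Z) <o> f = 0.
Proof. by apply: (addrI (0 <o> f)); rewrite -compDl !addr0. Qed.

Lemma comp0r X Y Z (g : Y ~> Z) : g <o> (0 : X ~> Y) = 0.
Proof. by apply: (addrI (g <o> 0)); rewrite -compDr !addr0. Qed.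

Lemma compNl X Y Z (g : Y ~> Z) (f : X ~> Y) : (- g) <o> f = - (g <o> f).
Proof. by apply: (addrI (g <o> f)); rewrite -compDl !subrr comp0l. Qed.

Lemma compNr X Y Z (g : Y ~> Z) (f : X ~> Y) : g <o> (- f) = - (g <o> f).
Proof. by apply: (addrI (g <o> f)); rewrite -compDr !subrr comp0r. Qed.

Lemma compBl X Y Z (g g' : Y ~> Z) (f : X ~> Y) :
  (g - g') <o> f = g <o> f - g' <o> f.
Proof. by rewrite compDl compNl. Qed.

Lemma compBr X Y Z (g : Y ~> Z) (f f' : X ~> Y) :
  g <o> (f - f') = g <o> f - g <o> f'.
Proof. by rewrite compDr compNr. Qed.

Lemma comp_suml (I : finType) X Y Z (G : I -> (Y ~> Z)) (f : X ~> Y) :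
  (\sum_i G i) <o> f = \sum_i (G i <o> f).
Proof.
by elim/big_rec2: _ => [|i g g' _ <-]; rewrite ?comp0l ?compDl.
Qed.

Lemma comp_sumr (I : finType) X Y Z (g : Y ~> Z) (F : I -> (X ~> Y)) :
  g <o> (\sum_i F i) = \sum_i (g <o> F i).
Proof.
by elim/big_rec2: _ => [|i f f' _ <-]; rewrite ?comp0r ?compDr.
Qed.

Lemma is_iso_id X : is_iso (idm X).
Proof. by exists (idm X); rewrite comp_idl. Qed.

Lemma is_iso_comp X Y Z (g : Y ~> Z) (f : X ~> Y) :
  is_iso g -> is_iso f -> is_iso (g <o> f).
Proof.
move=> [g' [g'g gg']] [f' [f'f ff']]; exists (f' <o> g').
split; first by rewrite compA -(compA f') g'g comp_idr.
by rewrite compA -(compA g) ff' comp_idr.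
Qed.

Lemma isomorphic_refl X : isomorphic X X.
Proof. by exists (idm X); exact: is_iso_id. Qed.

Lemma isomorphic_sym X Y : isomorphic X Y -> isomorphic Y X.
Proof. by move=> [f [g [gf fg]]]; exists g, f. Qed.

Lemma isomorphic_trans Y X Z :
  isomorphic X Y -> isomorphic Y Z -> isomorphic X Z.
Proof. by move=> [f isof] [g isog]; exists (g <o> f); exact: is_iso_comp. Qed.

Lemma iso_cls_eq X Y : isomorphic X Y -> iso_cls X = iso_cls Y.
Proof.
by apply: cls_eq; [exact: isomorphic_sym | move=> ? ? ?; exact: isomorphic_trans].
Qed.

Lemma iso_cls_inj X Y : iso_cls X = iso_cls Y -> isomorphic X Y.
Proof. by apply: cls_inj; exact: isomorphic_refl. Qed.

Lemma isomorphic_zobjP X : isomorphic X zobj <-> idm X = 0.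
Proof.
split=> [[f [g [<- _]]]|idX0]; first by rewrite (zobj_terminal f) comp0r.
by exists 0, 0; rewrite idX0 !comp0l (zobj_initial (idm zobj)).
Qed.

Lemma is_iso_pr2 X Y : isomorphic X zobj -> is_iso (@pr2 A X Y).
Proof.
move/isomorphic_zobjP=> X0; exists in2; split; last exact: pr2_in2.
by rewrite -[RHS]oplus_id -(comp_idr in1) X0 comp0r comp0l add0r.
Qed.

Lemma is_iso_in1 X Y : isomorphic Y zobj -> is_iso (@in1 A X Y).
Proof.
move/isomorphic_zobjP=> Y0; exists pr1; split; first exact: pr1_in1.
by rewrite -[RHS]oplus_id -(comp_idr in2) Y0 comp0r comp0l addr0.
Qed.

Definition idempotent_splits X (e : X ~> X) : Prop :=
  exists (W : A) (r : X ~> W) (i : W ~> X), r <o> i = idm W /\ i <o> r = e.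

(** The complement [T] is the image of the idempotent [idm Y - i <o> r]; the isomorphism has
    components [i] and [j], its inverse [r] and [q]. *)
Lemma retract_summand X Y (i : X ~> Y) (r : Y ~> X) :
  r <o> i = idm X -> idempotent_splits (idm Y - i <o> r) ->
  exists (T : A) (b : X (+o) T ~> Y), is_iso b /\ b <o> in1 = i.
Proof.
move=> ri [T [q [j [qj jq]]]].
have e0 : (idm Y - i <o> r) <o> i = 0.
  by rewrite compBl comp_idl -compA ri comp_idr subrr.
have e1 : r <o> (idm Y - i <o> r) = 0.
  by rewrite compBr comp_idr compA ri comp_idl subrr.
have qi : q <o> i = 0.
  by rewrite -(comp_idl (q <o> i)) -qj -compA (compA j) jq e0 comp0r.
have rj : r <o> j = 0.
  by rewrite -(comp_idr (r <o> j)) -qj -compA (compA j) jq compA e1 comp0l.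
exists T, (i <o> pr1 + j <o> pr2); split; last first.
  by rewrite compDl -!compA pr1_in1 pr2_in1 comp0r comp_idr addr0.
exists (in1 <o> r + in2 <o> q); split.
  rewrite !compDl !compDr -!compA !(compA r) !(compA q) ri rj qi qj.
  by rewrite !comp0l !comp_idl !comp0r addr0 add0r oplus_id.
rewrite !compDl !compDr -!compA !(compA pr1) !(compA pr2).
rewrite pr1_in1 pr1_in2 pr2_in1 pr2_in2 !comp0l !comp_idl !comp0r addr0 add0r jq.
by rewrite addrC subrK.
Qed.

(** A decomposition of [X] writes the identity as a sum of two idempotents. Locality makes one of
    them invertible, hence the identity, so the other idempotent and its summand vanish. *)
Lemma local_End_indecomposable X : local_End X -> indecomposable X.
Proof.
move=> [X0 locX]; split; first by move/isomorphic_zobjP.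
move=> Y Z [f [g [gf fg]]].
pose e1 : X ~> X := g <o> (in1 <o> pr1) <o> f.
pose e2 : X ~> X := g <o> (in2 <o> pr2) <o> f.
have e12 : e1 + e2 = idm X by rewrite -compDl -compDr oplus_id comp_idr gf.
have iso_id e : is_iso e -> e <o> e = e -> e = idm X.
  by move=> [h [he _]] ee; rewrite -he -ee compA he comp_idl.
have e1e1 : e1 <o> e1 = e1.
  rewrite /e1 -!compA (compA f) fg comp_idl (compA pr1) pr1_in1.
  by rewrite comp_idl.
have e2e2 : e2 <o> e2 = e2.
  rewrite /e2 -!compA (compA f) fg comp_idl (compA pr2) pr2_in2.
  by rewrite comp_idl.
have [ie1|nie1] := pselect (is_iso e1).
  right; apply/isomorphic_zobjP.
  have e20 : e2 = 0.
    by apply: (addrI e1); rewrite e12 addr0; apply/esym/iso_id.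
  have -> : idm Z = pr2 <o> f <o> e2 <o> g <o> in2.
    rewrite /e2 -!compA (compA f) fg comp_idl (compA f) fg comp_idl.
    by rewrite (compA pr2) pr2_in2 comp_idl.
  by rewrite e20 comp0r !comp0l.
have [ie2|nie2] := pselect (is_iso e2); last first.
  by case: (locX _ _ nie1 nie2); rewrite e12; exact: is_iso_id.
left; apply/isomorphic_zobjP.
have e10 : e1 = 0.
  by apply: (addIr e2); rewrite e12 add0r; apply/esym/iso_id.
have -> : idm Y = pr1 <o> f <o> e1 <o> g <o> in1.
  rewrite /e1 -!compA (compA f) fg comp_idl (compA f) fg comp_idl.
  by rewrite (compA pr1) pr1_in1 comp_idl.
by rewrite e10 comp0r !comp0l.
Qed.

End AdditiveCategory.

(** * Extriangulated length categories *)

Section Biadditive.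
Variables (A : addCat) (E : biaddFunctor A).

Lemma push_zero (C X X' : A) (d : E C X) : push (0 : X ~> X') d = 0.
Proof. by apply: (addrI (push 0 d)); rewrite -push_add !addr0. Qed.

Lemma pull_zero (C C' X : A) (d : E C X) : pull (0 : C' ~> C) d = 0.
Proof. by apply: (addrI (pull 0 d)); rewrite -pull_add !addr0. Qed.

Lemma seq3_equiv_refl (X Z : A) (p : seq3 X Z) : seq3_equiv p p.
Proof. by exists (idm _); rewrite comp_idl comp_idr; split=> //; exact: is_iso_id. Qed.

Lemma seq3_equiv_sym (X Z : A) (p q : seq3 X Z) : seq3_equiv p q -> seq3_equiv q p.
Proof.
move=> [b [[c [cb bc]] bp qb]]; exists c; split; first by exists b.
  by rewrite -bp compA cb comp_idl.
by rewrite -qb -compA bc comp_idr.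
Qed.

Lemma seq3_equiv_trans (X Z : A) (p q r : seq3 X Z) :
  seq3_equiv p q -> seq3_equiv q r -> seq3_equiv p r.
Proof.
move=> [b [isob bp qb]] [c [isoc cq rc]]; exists (c <o> b).
by split; [exact: is_iso_comp | rewrite -compA bp | rewrite compA rc].
Qed.

Variable s : assignment E.

Lemma etriangle_iso (X B C B' : A) (x : X ~> B) (y : B ~> C) (d : E C X)
    (x' : X ~> B') (y' : B' ~> C) (b : B ~> B') :
  is_iso b -> b <o> x = x' -> y' <o> b = y ->
  etriangle s x y d -> etriangle s x' y' d.
Proof.
rewrite /etriangle => isob bx y'b ->; apply: cls_eq; last by exists b.
- exact: seq3_equiv_sym.
- exact: seq3_equiv_trans.
Qed.

Lemma etriangle_uniq (X B C B' : A) (x : X ~> B) (y : B ~> C) (d : E C X)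
    (x' : X ~> B') (y' : B' ~> C) :
  etriangle s x y d -> etriangle s x' y' d ->
  exists b : B ~> B', [/\ is_iso b, b <o> x = x' & y' <o> b = y].
Proof. by rewrite /etriangle => -> /(cls_inj (seq3_equiv_refl _)). Qed.

End Biadditive.

(** * Inflations, deflations and split idempotents *)

Section LengthCategory.
Variables (A : addCat) (E : biaddFunctor A) (s : assignment E).
Variable Theta : Iso A -> nat.
Hypothesis hlen : length_category s Theta.
Implicit Types X Y Z L M : A.

Local Notation len X := (Theta (iso_cls X)).
Local Notation infl := (inflation s Theta).

Lemma len_iso X Y : isomorphic X Y -> len X = len Y.
Proof. by move/iso_cls_eq->. Qed.

Lemma len_eq0 X : len X = 0%N <-> isomorphic X zobj.
Proof. by case: hlen => _ [+ _ _] _; apply. Qed.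

Lemma len_zobj : len (zobj : A) = 0%N.
Proof. exact/len_eq0/isomorphic_refl. Qed.

Lemma etriangle_split X Y : etriangle s (@in1 A X Y) (@pr2 A X Y) (0 : E Y X).
Proof. by case: hlen => [[[_ + _] _] _ _]; apply. Qed.

Lemma len_oplus X Y : len (X (+o) Y) = (len X + len Y)%N.
Proof.
by case: hlen => _ [_ _ +] _; apply; exact: (etriangle_split X Y).
Qed.

Lemma etriangle_idl X : etriangle s (idm X) (0 : X ~> zobj) (0 : E zobj X).
Proof.
apply: (etriangle_iso (b := pr1) _ _ _ (etriangle_split X zobj)).
- exists in1; split; last exact: pr1_in1.
  rewrite -[RHS]oplus_id (zobj_terminal pr2) comp0r addr0 //.
- exact: pr1_in1.
- by rewrite comp0l (zobj_terminal pr2).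
Qed.

Lemma etriangle_idr X : etriangle s (0 : zobj ~> X) (idm X) (0 : E X zobj).
Proof.
apply: (etriangle_iso (b := pr2) _ _ _ (etriangle_split zobj X)).
- by apply: is_iso_pr2; exact: isomorphic_refl.
- exact: pr2_in1.
- exact: comp_idl.
Qed.

Lemma stable_idm X : stable s Theta (idm X) (0 : X ~> zobj) (0 : E zobj X).
Proof. by split; [exact: etriangle_idl | rewrite len_zobj addn0]. Qed.

Lemma infl_in1 X Y : infl (@in1 A X Y).
Proof.
by exists Y, pr2, 0; split; [exact: etriangle_split | exact: len_oplus].
Qed.

Lemma infl_isol X Y Y' (b : Y ~> Y') (f : X ~> Y) :
  is_iso b -> infl f -> infl (b <o> f).
Proof.
move=> isob [M [y [d [tri lenY]]]]; have [c [cb _]] := isob.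
exists M, (y <o> c), d; split.
  by apply: etriangle_iso isob _ _ tri; rewrite -?compA ?cb ?comp_idr.
by rewrite -lenY; apply/len_iso/isomorphic_sym; exists b.
Qed.

Lemma infl_iso X Y (b : X ~> Y) : is_iso b -> infl b.
Proof.
move=> isob; rewrite -(comp_idr b); apply: infl_isol => //.
by exists zobj, 0, 0; exact: stable_idm.
Qed.

Lemma len_infl X Y (f : X ~> Y) : infl f -> (len X <= len Y)%N.
Proof. by move=> [M [y [d [_ ->]]]]; exact: leq_addr. Qed.

Lemma len_defl X Y (f : X ~> Y) : deflation s Theta f -> (len Y <= len X)%N.
Proof. by move=> [M [y [d [_ ->]]]]; exact: leq_addl. Qed.

(** Subadditivity on the two triangles given by [ET4] yields opposite inequalities between the
    length of [Z] and that of [X] plus [G], so the composite triangle is stable. *)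
Lemma infl_comp X Y Z (g : Y ~> Z) (f : X ~> Y) : infl g -> infl f -> infl (g <o> f).
Proof.
move=> [F [g' [d' [trig lenZ]]]] [D [f' [d [trif lenY]]]].
have [[_ [_ _ ET4s _]] [_ subadd _] _] := hlen.
have [G [h' [d1 [e [d'' [[_ _ trigf] [trie _ _]]]]]]] :=
  ET4s _ _ _ _ _ _ _ _ _ _ _ trif trig.
exists G, h', d''; split=> //.
by have := subadd _ _ _ _ _ _ trigf; have := subadd _ _ _ _ _ _ trie; lia.
Qed.

(** The third term has length zero, so it is a zero object and the extension vanishes; by uniqueness
    of realizations [f] is then [in1] up to isomorphism. *)
Lemma infl_len_iso X Y (f : X ~> Y) : infl f -> len X = len Y -> is_iso f.
Proof.
move=> [M [y [d [tri ->]]]] lenM.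
have /len_eq0 M0 : len M = 0%N by lia.
have d0 : d = 0.
  by rewrite -(pull_id d) (isomorphic_zobjP M).1 // pull_zero.
rewrite d0 in tri; have [b [isob <- _]] := etriangle_uniq (etriangle_split X M) tri.
by apply: is_iso_comp isob _; exact: is_iso_in1.
Qed.

Lemma defl_len_iso X Y (f : X ~> Y) :
  deflation s Theta f -> len X = len Y -> is_iso f.
Proof.
move=> [K [x [d [tri ->]]]] lenK.
have /len_eq0 K0 : len K = 0%N by lia.
have d0 : d = 0.
  by rewrite -(push_id d) (isomorphic_zobjP K).1 // push_zero.
rewrite d0 in tri; have [b [isob _ <-]] := etriangle_uniq tri (etriangle_split K Y).
by apply: is_iso_comp _ isob; exact: is_iso_pr2.
Qed.

(* Write [e = i p] with middle object [W]; if [W] is shorter than [X], pass to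
   the idempotent [(p i)^2] of [W], otherwise [p] and [i] are isomorphisms. *)
Lemma idempotents_split X (e : X ~> X) : e <o> e = e -> idempotent_splits e.
Proof.
have [n] := ubnP (len X); elim: n X e => // n IHn X e lenX ee.
have [_ _ /(_ _ _ e) [W [p [i [deflp infli eip]]]]] := hlen.
have lenW := len_infl infli.
have [eqlen|nelen] := eqVneq (len W) (len X).
  have [h [he _]] : is_iso e.
    by rewrite eip; apply: is_iso_comp; [exact: infl_len_iso | exact: defl_len_iso].
  exists X, e, (idm X); rewrite comp_idr comp_idl; split=> //.
  by rewrite -he -[in RHS]ee compA he comp_idl.
pose r := p <o> i.
(* Neither [p] nor [i] is known to be cancellable, so only the square of [r], not [r] itself, is
   shown to be idempotent. *)
have rrr : r <o> r <o> r = r <o> r.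
  have -> : r <o> r <o> r = p <o> (e <o> e) <o> i by rewrite eip /r !compA.
  by rewrite ee eip /r !compA.
have [||T [q [j [qj jq]]]] := IHn W (r <o> r).
- by apply: leq_trans (_ : _ <= len X)%N _; rewrite // ltn_neqAle nelen.
- by rewrite compA !rrr.
(* The extra [r] turns one composite into [q <o> (r <o> r) <o> j], an identity, and the other into
   the fourth power of [e]. *)
exists T, (q <o> p), (i <o> r <o> j); split.
  have -> : q <o> p <o> (i <o> r <o> j) = q <o> (r <o> r) <o> j by rewrite /r !compA.
  by rewrite -jq !compA qj comp_idl qj.
have -> : i <o> r <o> j <o> (q <o> p) = i <o> r <o> (j <o> q) <o> p by rewrite !compA.
rewrite jq.
have -> : i <o> r <o> (r <o> r) <o> p = e <o> e <o> (e <o> e) by rewrite eip /r !compA.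
by rewrite !ee.
Qed.

Lemma section_summand X Y (i : X ~> Y) (r : Y ~> X) :
  r <o> i = idm X -> exists (T : A) (b : X (+o) T ~> Y), is_iso b /\ b <o> in1 = i.
Proof.
move=> ri; apply: (retract_summand ri); apply: idempotents_split.
rewrite compBr compBl comp_idl comp_idr compBl comp_idl.
by rewrite -compA (compA r) ri comp_idl subrr subr0.
Qed.

Lemma section_infl X Y (i : X ~> Y) (r : Y ~> X) : r <o> i = idm X -> infl i.
Proof.
by move=> /section_summand[T [b [isob <-]]]; apply: infl_isol => //; exact: infl_in1.
Qed.

(** By [ET3], the zero map on [X] and the identity of [Y] extend to a morphism into the triangle
    [zobj -> Y -> Y], which makes [y] a section. Then [Y] is no longer than [M], and this leaves
    length zero for [X]. *)
Lemma infl_zero X Y : infl (0 : X ~> Y) -> isomorphic X zobj.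
Proof.
move=> [M [y [d [tri lenY]]]]; have [[_ [ET3s _ _ _]] _ _] := hlen.
have [|q [_ qy]] := ET3s _ _ _ _ _ _ _ _ _ _ _ _ (0 : X ~> zobj) (idm Y)
  tri (etriangle_idr Y).
  by rewrite !comp0r.
have : (len Y <= len M)%N.
  by apply/len_infl/(section_infl (i := y) (r := q)); rewrite -qy comp_idl.
by move=> le; apply/len_eq0; lia.
Qed.

(** A complement [T] of [X] in [Y] is zero, as [Y] is indecomposable and [X] is nonzero, so the
    lengths agree. *)
Lemma infl_section_summand X Y (x : X ~> Y) (r : Y ~> X) :
  infl x -> r <o> x = idm X -> indecomposable X -> indecomposable Y -> is_iso x.
Proof.
move=> inflx rx indX indY; apply: infl_len_iso => //.
have [T [b [isob _]]] := section_summand rx.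
have isoY : isomorphic Y (X (+o) T) by apply: isomorphic_sym; exists b.
have [X0|T0] := indY.2 _ _ isoY; first by case: indX.1.
by rewrite (len_iso isoY) len_oplus (len_eq0 T).2 ?addn0.
Qed.

End LengthCategory.

(** * The Gabriel-Roiter measure *)

Section GabrielRoiterMeasure.
Variables (A : addCat) (E : biaddFunctor A) (s : assignment E).
Variable Theta : Iso A -> nat.
Hypothesis hlen : length_category s Theta.
Implicit Types X Y Z L M : A.

Local Notation len X := (Theta (iso_cls X)).
Local Notation infl := (inflation s Theta).
Local Notation mu X := (GR_measure s Theta (iso_cls X)).
Local Notation chain X := (Ch_at (@ind A) (ind_le s Theta) (iso_cls X)).
Local Notation lens C := (fset_set (Theta @` C)).

(** Other representatives change an inflation only by isomorphisms on both sides, and these preserve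
    inflations. *)
Lemma ind_leP X Y :
  ind_le s Theta (iso_cls X) (iso_cls Y) <-> exists f : X ~> Y, infl f.
Proof.
split=> [[X' [Y' [f [/iso_cls_inj[a isoa] eqY inflf]]]]|[f inflf]]; last by exists X, Y, f.
have [b isob] := iso_cls_inj (esym eqY).
exists (b <o> (f <o> a)); apply: infl_isol => //.
by apply: infl_comp => //; exact: infl_iso.
Qed.

Lemma ind_le_len c c' : ind_le s Theta c c' -> (Theta c <= Theta c')%N.
Proof. by move=> [X [Y [f [-> -> /len_infl]]]]. Qed.

Lemma ind_le_eq c c' : ind_le s Theta c c' -> Theta c = Theta c' -> c = c'.
Proof.
move=> [X [Y [f [-> -> inflf]]]] eqlen; apply: iso_cls_eq; exists f.
exact: infl_len_iso hlen _ _ _ inflf eqlen.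
Qed.

Lemma ind_le_refl c : ind c -> ind_le s Theta c c.
Proof. by move=> [X _ <-]; apply/ind_leP; exists (idm X); exact/infl_iso/is_iso_id. Qed.

Lemma mem_lens X C i : chain X C -> i \in lens C <-> exists2 c, C c & Theta c = i.
Proof.
move=> [[finC _ _] _]; rewrite in_fset_set; last exact: finite_image.
by rewrite inE.
Qed.

Lemma lens_le X C i : chain X C -> i \in lens C -> (i <= len X)%N.
Proof.
move=> chC /(mem_lens _ chC)[c Cc <-]; apply: ind_le_len.
by case: chC => _ [_]; apply.
Qed.

Lemma chain_cons X Y C (f : X ~> Y) : indecomposable Y -> infl f ->
  chain X C -> chain Y (iso_cls Y |` C).
Proof.
move=> indY inflf [[finC Cind tot] [CX maxX]].
have indclsY : ind (iso_cls Y) by exists Y.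
have maxY c : (iso_cls Y |` C) c -> ind_le s Theta c (iso_cls Y).
  move=> [->|Cc]; first exact: ind_le_refl.
  have [Z _ eqZ] := Cind _ Cc; move: (maxX _ Cc); rewrite -eqZ.
  by move=> /ind_leP[g inflg]; apply/ind_leP; exists (f <o> g); exact: infl_comp.
split; last by split=> //; left.
split; first by rewrite finite_setU; split.
  by move=> c [->|/Cind].
move=> a b [->|Ca] Cb; first by right; exact: maxY.
case: Cb => [->|Cb]; last exact: tot.
by left; apply: maxY; right.
Qed.

Lemma chain1 X : indecomposable X -> chain X [set iso_cls X].
Proof.
move=> indX; have indc : ind (iso_cls X) by exists X.
split; last by split=> // c ->; exact: ind_le_refl.
by split=> // [c ->//|a b -> ->]; left; exact: ind_le_refl.
Qed.

(** Ensures that [max_Ch] does not fall back on its default: the one-element chain exists, and all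
    lengths in a chain are bounded by that of [X]. *)
Lemma GR_measure_max X : indecomposable X ->
  is_max [set lens C | C in chain X] (mu X).
Proof.
move=> indX; rewrite /GR_measure /max_Ch; apply: xgetPex.
apply: (@is_max_exists _ (len X)).
  by exists (lens [set iso_cls X]), [set iso_cls X] => //; exact: chain1.
by move=> _ i [C chC <-]; exact: lens_le.
Qed.

Lemma GR_measure_le_len X i : indecomposable X -> i \in mu X -> (i <= len X)%N.
Proof.
by move=> /GR_measure_max[[C chC <-] _]; exact: lens_le.
Qed.

Lemma len_GR_measure X : indecomposable X -> len X \in mu X.
Proof.
move=> /GR_measure_max[[C chC <-] _]; apply/(mem_lens _ chC).
by exists (iso_cls X) => //; case: chC => _ [].
Qed.

(** Any new entry enlarges a set in the lexicographical order, and [len Y] is new because it exceeds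
    every length in an optimal chain for [X]. *)
Lemma GR_measure_lt X Y (f : X ~> Y) : indecomposable X -> indecomposable Y ->
  infl f -> (len X < len Y)%N -> lex_lt (mu X) (mu Y).
Proof.
move=> indX indY inflf ltXY.
have [_ maxY] := GR_measure_max indY; have [[C chC <-] _] := GR_measure_max indX.
have finC : finite_set (Theta @` C) by apply: finite_image; case: chC => -[].
apply: lex_lt_le_trans (maxY _ _); last first.
  by exists (iso_cls Y |` C) => //; exact: (chain_cons indY inflf chC).
rewrite image_setU image_set1 fset_setU1 //; apply: lex_lt_fsetU1.
by apply/negP => /(lens_le chC); rewrite leqNgt ltXY.
Qed.

Lemma GR_measure_le X Y (f : X ~> Y) : indecomposable X -> indecomposable Y ->
  infl f -> lex_le (mu X) (mu Y).
Proof.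
move=> indX indY inflf; apply/lex_leP.
have := len_infl inflf; rewrite leq_eqVlt => /predU1P[eqlen|ltlen].
  left; congr GR_measure; apply: iso_cls_eq; exists f.
  exact: infl_len_iso hlen _ _ _ inflf eqlen.
by right; exact: GR_measure_lt inflf ltlen.
Qed.

(** [U] comes from an optimal chain with [X] removed. If anything remains, it is a chain ending at
    its longest member [X'], so it competes for the measure of [X']. *)
Lemma GR_measure_rec X : indecomposable X -> exists U : {fset nat},
  mu X = (len X |` U)%fset /\
  (U = fset0 \/ exists (X' : A) (x : X' ~> X),
    [/\ indecomposable X', infl x, (len X' < len X)%N & lex_le U (mu X')]).
Proof.
move=> indX; have [[C chC <-] _] := GR_measure_max indX.
have [[finC Cind tot] [CX maxX]] := chC.
pose D := C `\ iso_cls X; have finD : finite_set D by exact: finite_setD.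
exists (lens D); split.
  rewrite -fset_setU1; last exact: finite_image.
  by rewrite -image_set1 -image_setU setD1K.
have ltX c : D c -> (Theta c < len X)%N.
  move=> [Cc neX]; rewrite ltn_neqAle ind_le_len ?andbT; last exact: maxX.
  by apply/eqP => eqlen; apply: neX; apply: ind_le_eq eqlen; exact: maxX.
have [D0|/eqP/set0P[c0 Dc0]] := pselect (D = set0).
  by left; rewrite D0 image_set0 fset_set0.
right.
(* Comparable members of equal length coincide, so a longest member of [D] will be its greatest
   element. *)
pose P n := `[< exists2 c, D c & Theta c = n >].
have exP : exists n, P n by exists (Theta c0); apply/asboolP; exists c0.
have bndP n : P n -> (n <= len X)%N by move=> /asboolP[c /ltX/ltnW lec <-].
case: (ex_maxnP exP bndP) => m /asboolP[c Dc <-] mmax.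
have [X' indX' eqc] := Cind _ Dc.1; subst c.
have /ind_leP[x inflx] := maxX _ Dc.1.
exists X', x; split=> //; first exact: ltX.
have [_ maxX'] := GR_measure_max indX'; apply: maxX'; exists D => //.
split; first by split=> // [c [/Cind]//|a b [Ca _] [Cb _]]; exact: tot.
split=> // c Dc'; have [//|le] := tot _ _ Dc'.1 Dc.1.
have -> : c = iso_cls X'; last by apply: ind_le_refl; exists X'.
apply/esym/ind_le_eq => //; apply/eqP; rewrite eqn_leq ind_le_len //=.
by apply: mmax; apply/asboolP; exists c.
Qed.

End GabrielRoiterMeasure.

(** * Comparison of measures along an inflation into a sum *)

Section MainProperty.
Variables (A : addCat) (E : biaddFunctor A) (s : assignment E).
Variable Theta : Iso A -> nat.
Hypothesis hKS : krull_schmidt A.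
Hypothesis hlen : length_category s Theta.
Implicit Types X Y Z L M : A.

Local Notation len X := (Theta (iso_cls X)).
Local Notation infl := (inflation s Theta).
Local Notation mu X := (GR_measure s Theta (iso_cls X)).

(** Kept as data rather than a proposition, so that a factorization can be chosen for every
    component and all the pieces indexed by one finite type. *)
Record short_factorization X Y (f : X ~> Y) := ShortFactorization {
  sf_size : nat;
  sf_mid : 'I_sf_size -> A;
  sf_in : forall u, X ~> sf_mid u;
  sf_out : forall u, sf_mid u ~> Y;
  sf_sum : f = \sum_u sf_out u <o> sf_in u;
  sf_ind : forall u, indecomposable (sf_mid u);
  sf_infl : forall u, infl (sf_out u);
  sf_len : forall u, (len (sf_mid u) < len X)%N
}.

Lemma infl_or_short_factorization X Y (f : X ~> Y) :
  infl f \/ exists _ : short_factorization f, True.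
Proof.
have [_ _ /(_ _ _ f) [Z [p [j [deflp inflj ->]]]]] := hlen.
have [eqlen|nelen] := eqVneq (len Z) (len X).
  by left; apply: infl_comp => //; apply: infl_iso => //; exact: defl_len_iso deflp _.
have ltZX : (len Z < len X)%N by rewrite ltn_neqAle nelen; exact: len_defl deflp.
right; have [n [W [iota [pi [[piiota _ sum1] locW]]]]] := hKS Z.
have infl_iota u : infl (iota u) by exact: section_infl (piiota u).
unshelve eexists; last by [].
apply: (@ShortFactorization _ _ _ n W (fun u => pi u <o> p) (fun u => j <o> iota u)).
- under eq_bigr do rewrite -compA (compA (iota _)).
  by rewrite -comp_sumr -comp_suml sum1 comp_idl.
- by move=> u; exact: local_End_indecomposable.
- by move=> u; exact: infl_comp.
- by move=> u; apply: leq_ltn_trans ltZX; exact: len_infl (infl_iota u).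
Qed.

(* The target direct sum is replaced by arbitrary maps [g i] into some [L]:
   this form is stable under factoring the components [f i], whereas for a
   direct sum one would have to cancel an inflation on the left. *)
Lemma GR_measure_dichotomy (I : finType) X L (Y : I -> A)
    (f : forall i, X ~> Y i) (g : forall i, Y i ~> L) :
  indecomposable X -> (forall i, indecomposable (Y i)) ->
  infl (\sum_i g i <o> f i) ->
  (exists i, lex_lt (mu X) (mu (Y i))) \/ exists i, is_iso (f i).
Proof.
have [n] := ubnP (len X).
elim: n I X L Y f g => // n IHn I X L Y f g lenX indX indY inflgf.
have [[i inflf]|noinfl] := pselect (exists i, infl (f i)).
  have := len_infl inflf; rewrite leq_eqVlt => /predU1P[eqlen|ltlen].
    by right; exists i; exact: infl_len_iso hlen _ _ _ inflf eqlen.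
  by left; exists i; exact: GR_measure_lt inflf ltlen.
have exF i : exists _ : short_factorization (f i), True.
  have [inflf|//] := infl_or_short_factorization (f i).
  by case: noinfl; exists i.
have F i : short_factorization (f i) := sval (cid (exF i)).
(* [J] collects the pieces of all the factorizations, so that the given inflation becomes a single
   sum through shorter indecomposables. *)
pose J := {i : I & 'I_(sf_size (F i))}.
pose W (w : J) := sf_mid (tagged w).
pose a (w : J) : X ~> W w := sf_in (tagged w).
pose b (w : J) : W w ~> L := g (tag w) <o> sf_out (tagged w).
have sumE : \sum_i g i <o> f i = \sum_w b w <o> a w.
  rewrite -(sig_big_dep xpredT (fun _ => xpredT)
    (fun i u => (g i <o> sf_out u) <o> sf_in (s := F i) u)).
  apply: eq_bigr => i _; rewrite {1}(sf_sum (F i)) comp_sumr.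
  by apply: eq_bigr => u _; rewrite compA.
have leWY w : lex_le (mu (W w)) (mu (Y (tag w))).
  by apply: GR_measure_le (sf_infl (tagged w)) => //; exact: sf_ind.
(* All entries of [mu (W w)] are below [len X], so it is enough to compare after dropping [len X]
   from the measure of [X]. *)
suff [U [w [-> ltUW]]] : exists U w, mu X = (len X |` U)%fset /\ lex_lt U (mu (W w)).
  left; exists (tag w); apply: lex_lt_le_trans (leWY w).
  apply: fsetU1_lex_lt ltUW => i /GR_measure_le_len => /(_ hlen (sf_ind _)) lei.
  exact: leq_ltn_trans lei (sf_len _).
have [U [muX [U0|[X' [x [indX' inflx ltX' leU]]]]]] := GR_measure_rec hlen indX.
  (* Here the measure of [X] is [len X] alone, and any piece beats the empty [U]. With no pieces the
     inflation would be zero, forcing [X] to be zero. *)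
  exists U; have [[w _]|noW] := pselect (exists w : J, True).
    exists w; rewrite {2}U0; split=> //; apply: lex_lt0.
    by apply: len_GR_measure => //; exact: sf_ind.
  have sum0 : \sum_w b w <o> a w = 0 by apply: big1 => w _; case: noW; exists w.
  by case: indX.1; rewrite sumE sum0 in inflgf; exact: infl_zero inflgf.
(* Precomposed with [x], the sum is still an inflation, and [X'] is shorter than [X]. *)
have [||||[w ltw]|[w isow]] := IHn J X' L W (fun w => a w <o> x) b.
- by apply: leq_trans ltX' _.
- by [].
- by move=> w; exact: sf_ind.
- under eq_bigr do rewrite compA.
  by rewrite -comp_suml -sumE; exact: infl_comp.
- by exists U, w; split=> //; exact: lex_le_lt_trans ltw.
(* An inverse of [a w <o> x] yields a retraction of [x], so the strictly shorter [X'] would be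
   isomorphic to the indecomposable [X]. *)
have [c [cax _]] := isow.
have isox : is_iso x.
  by apply: (infl_section_summand hlen (r := c <o> a w)); rewrite // -compA.
by move: ltX'; rewrite (@len_iso _ Theta X' X) ?ltnn //; exists x.
Qed.

End MainProperty.

Local Close Scope ring_scope.

Theorem theorem3p6 (A : addCat) (E : biaddFunctor A) (s : assignment E)
    (Theta : Iso A -> nat)
    (hKS : krull_schmidt A)
    (hlen : length_category s Theta)
    (n : nat) (X : A) (Y : 'I_n -> A)
    (hX : indecomposable X) (hY : forall i, indecomposable (Y i))
    (k : 'I_n)
    (hk : is_max [set GR_measure s Theta (iso_cls (Y i)) | i in [set: 'I_n]]
                 (GR_measure s Theta (iso_cls (Y k))))
    (S : A) (iota : forall i, Y i ~> S) (pi : forall i, S ~> Y i)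
    (hS : is_direct_sum iota pi)
    (f : X ~> S)
    (hf : inflation s Theta f) :
  lex_le (GR_measure s Theta (iso_cls X)) (GR_measure s Theta (iso_cls (Y k))) /\
  (GR_measure s Theta (iso_cls X) = GR_measure s Theta (iso_cls (Y k)) ->
   exists t : 'I_n,
     is_iso (pi t <o> f) /\
     GR_measure s Theta (iso_cls (Y t)) = GR_measure s Theta (iso_cls (Y k))).
Proof.
have maxk i : lex_le (GR_measure s Theta (iso_cls (Y i)))
    (GR_measure s Theta (iso_cls (Y k))).
  by apply: hk.2; exists i.
have [_ _ sum1] := hS.
(* The direct sum identity puts [f] in the form of the dichotomy, with [L] the sum [S] and [g] the
   inclusions. *)
have sumf : (\sum_i iota i <o> (pi i <o> f))%R = f.
  under eq_bigr do rewrite compA.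
  by rewrite -comp_suml sum1 comp_idl.
have [|[i lti]|[t isot]] := GR_measure_dichotomy hKS hlen
  (f := fun i => pi i <o> f) (g := iota) hX hY.
- by rewrite sumf.
(* A strict inequality excludes equality of the measures, so the second claim is vacuous here. *)
- have ltk := lex_lt_le_trans lti (maxk i).
  split=> [|eqk]; first by apply/lex_leP; right.
  by case: (@lex_ltxx (GR_measure s Theta (iso_cls X))); rewrite {2}eqk.
have eqt : iso_cls X = iso_cls (Y t) by apply: iso_cls_eq; exists (pi t <o> f).
split; first by rewrite eqt.
by move=> eqk; exists t; rewrite -eqt.
Qed.
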